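(* Let $X$ be a real Hilbert space, $C$ a nonempty closed convex subset of $X$, $f:C\to C$ an $\alpha$-contraction for some $\alpha\in(0,1)$, and let $A:X\to X$ be a $\mu$-inverse-strongly monotone mapping ($\mu>0$) such that $\mathrm{VI}(C,A)\ne\emptyset$. Let $\{\alpha_n\}$ be a sequence of real numbers such that: (i) $\alpha_n\in(0,1)$ for all $n$; (ii) $\lim_{n\to\infty}\alpha_n=0$; (iii) $\sum_{n=0}^\infty\alpha_n=\infty$; and either (iv) $\sum_{n=0}^\infty|\alpha_{n+1}-\alpha_n|<\infty$ or (iv') $\lim_{n\to\infty}\alpha_{n+1}/\alpha_n=1$. Let $\{\lambda_n\}$ be such that $\lambda_n\in[a,b]$ for some $a,b$ with $0<a<b<2\mu$ and $\sum_{n=1}^\infty|\lambda_{n+1}-\lambda_n|<\infty$. For $\lambda>0$ let $T_\lambda(x):=P_C(x-\lambda Ax)$. Let $x_0\in C$ and $$x_{n+1}=\alpha_nf(x_n)+(1-\alpha_n)P_C(x_n-\lambda_nAx_n).$$ Then the set $F=\mathrm{Fix}(T_\lambda)$ does not depend on $\lambda$ for $\lambda>0$ and equals $\mathrm{VI}(C,A)$, and $\{x_n\}$ converges strongly to $\mathbf{Q}_F(f)$.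
   Context: $f:C\to C$ is an $\alpha$-contraction ($\alpha\in(0,1)$) if $\|f(x)-f(y)\|\le\alpha\|x-y\|$ for all $x,y\in C$. $P_C$ is the metric projection from $X$ onto $C$. $\mathrm{Fix}(T)=\{x\in C:Tx=x\}$. $\mathrm{VI}(C,A)$ is the set of $x\in C$ such that $\langle Ax,y-x\rangle\ge0$ for all $y\in C$. $A$ is $\mu$-inverse-strongly monotone if $\langle x-y,Ax-Ay\rangle\ge\mu\|Ax-Ay\|^2$ for all $x,y\in C$. Definition of $\mathbf{Q}_F(f)$: let $T:C\to C$ be nonexpansive (i.e. $\|Tx-Ty\|\le\|x-y\|$) with $\mathrm{Fix}(T)=F\neq\emptyset$. For $u\in C$ and $t\in(0,1)$ let $z_t\in C$ be the unique fixed point of $x\mapsto tu+(1-t)Tx$, and let $R_T(u)=\lim_{t\to0}z_t$; in a Hilbert space this strong limit exists and $R_T$ is the metric projection of $C$ onto $F$. $\mathbf{Q}_F(f)$ is the unique fixed point $\tilde x=R_T(f(\tilde x))$ of the contraction $R_T\circ f$. *)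

(* Defs.v *)
From HB Require Import structures.
From mathcomp Require Import all_boot all_order all_algebra.
From mathcomp Require Import sesquilinear.
From mathcomp Require Import all_classical all_reals all_analysis.

Set Implicit Arguments.
Unset Strict Implicit.
Unset Printing Implicit Defensive.

Import Order.TTheory GRing.Theory Num.Theory.
Import numFieldNormedType.Exports.

Local Open Scope classical_set_scope.
Local Open Scope ring_scope.

(* A real Hilbert space is a complete normed module [X] over [R : realType]
   together with a symmetric positive definite bilinear form
   [dot : {dot X for idfun}] that induces the norm of [X]. *)

(* Self-maps of a subset [C] are either bundled as [{fun C >-> C}] or given as
   total functions on [X] of which only the values on [C] are used. *)

Section metric_projection.
Context {R : realType} {X : normedModType R}.

Definition nearest_points (C : set X) (x : X) : set X :=
  [set p | C p /\ forall y, C y -> `|x - p| <= `|x - y|].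

(* For [C] nonempty, closed and convex in a Hilbert space,
   [nearest_points C x] is a singleton. *)
Definition metric_proj (C : set X) (x : X) : X := get (nearest_points C x).

Definition Fix (C : set X) (T : X -> X) : set X := [set x | C x /\ T x = x].

Definition proj_step (C : set X) (A : X -> X) (lambda : R) (x : X) : X :=
  metric_proj C (x - lambda *: A x).

End metric_projection.

Section variational_inequality.
Context {R : realType} {X : normedModType R}.
Context (dot : {dot X for @idfun R}).

Definition VI (C : set X) (A : X -> X) : set X :=
  [set x | C x /\ forall y, C y -> 0 <= dot (A x) (y - x)].

Definition inverse_strongly_monotone (C : set X) (mu : R) (A : X -> X) : Prop :=
  forall x y, C x -> C y ->
    mu * `|A x - A y| ^+ 2 <= dot (x - y) (A x - A y).

End variational_inequality.

Section Q_operator.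
Context {R : realType} {X : normedModType R}.

Definition nonexpansive (C : set X) (T : {fun C >-> C}) : Prop :=
  1.-lipschitz_C T.

(* [z_t]: for [C] nonempty, closed and convex in a complete space, [T]
   nonexpansive, [u] in [C] and [0 < t < 1], the fixed point exists in [C] and
   is unique. *)
Definition approx_fix (C : set X) (T : X -> X) (u : X) (t : R) : X :=
  get [set z | C z /\ t *: u + (1 - t) *: T z = z].

Definition retract_lim (C : set X) (T : X -> X) (u : X) : X :=
  lim (approx_fix C T u t @[t --> 0^'+]).

(* [q] is the value of Q_F(f).  The value does not depend on the nonexpansive
   map [T] with fixed point set [F] used to define it, so the characterization
   is required of all such [T]; at least one is required to exist, which makes
   [q] unique. The [cvg] clause guards against the default value of [lim]. *)
Definition is_Q (C F : set X) (f : X -> X) (q : X) : Prop :=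
  (exists T : {fun C >-> C}, nonexpansive T /\ Fix C T = F) /\
  forall T : {fun C >-> C}, nonexpansive T -> Fix C T = F ->
    [/\ forall u, C u -> cvg (approx_fix C T u t @[t --> 0^'+]),
        C q,
        retract_lim C T (f q) = q &
        forall p, C p -> retract_lim C T (f p) = p -> p = q].

End Q_operator.

(* Main.v *)
(* VI(C, A) is the fixed point set F of each T_l = P_C (id - l A), and T_l is
   nonexpansive on C for 0 <= l <= 2 mu.  For T nonexpansive with fixed point
   set F, the points z_t are resolvents of the monotone map I - T, so that
   |u - z_t| increases as t decreases and |z_s - z_t|^2 is at most
   |u - z_s|^2 - |u - z_t|^2 for s <= t; hence z_t converges strongly, and its
   limit q is the only point of F with <u - q, p - q> <= 0 for all p in F.
   Xu's lemma gives |x_{n+1} - x_n| -> 0, and |x - T_l x| is nondecreasing in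
   l, so |x_n - T_a x_n| -> 0.  Monotonicity of I - T_a yields
   t <u - z_t, x_n - z_t> <= |x_n - T_a x_n| |x_n - z_t|; taking u = f(q) and t
   small bounds limsup <f(q) - q, x_n - q> by 0 without weak compactness, and
   Xu's lemma applied to |x_n - q|^2 concludes. *)
Require Import Defs.
From mathcomp Require Import all_boot all_order all_algebra.
From mathcomp Require Import sesquilinear.
From mathcomp Require Import all_classical all_reals all_analysis.
From mathcomp Require Import ring lra.
Set Implicit Arguments.
Unset Strict Implicit.
Unset Printing Implicit Defensive.
Import Order.TTheory GRing.Theory Num.Theory.
Import numFieldNormedType.Exports.
Local Open Scope classical_set_scope.
Local Open Scope ring_scope.

(** * Real series and a recursive inequality *)

Lemma nneseries_pinfty_cvg {R : realType} (u : nat -> R) :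
  (forall n, 0 <= u n) -> (\sum_(0 <= n <oo) (u n)%:E = +oo)%E ->
  series u @ \oo --> +oo.
Proof.
move=> u0 uoo; apply/cvgeryP; rewrite -uoo.
have -> : (fun n => (series u n)%:E) = (fun n => \sum_(0 <= k < n) (u k)%:E)%E.
  by apply/funext => n; rewrite sumEFin seriesEnat.
by apply: is_cvg_nneseries => n _ _; rewrite lee_fin.
Qed.

(* Xu's lemma *)
Lemma recursive_inequality_cvg0 {R : realType} (s g d e : nat -> R) :
  (forall n, 0 <= s n) -> (forall n, 0 <= g n <= 1) ->
  series g @ \oo --> +oo ->
  (forall c, 0 < c -> \forall n \near \oo, d n <= c) ->
  (forall n, 0 <= e n) -> cvgn (series e) ->
  (forall n, s n.+1 <= (1 - g n) * s n + g n * d n + e n) ->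
  s n @[n --> \oo] --> 0.
Proof.
move=> s0 g01 goo dle e0 /cvg_ex[/= l el] sS; apply/cvgrPdist_le => c c0.
have c3 : 0 < c / 3 by lra.
have c6 : 0 < c / 6 by lra.
(* With partial sums within [c / 6] of the limit [l], the sum of [e] between [N] and any later index
   is at most [c / 3]. *)
have [N _ NP] : \forall n \near \oo, d n <= c / 3 /\ `|l - series e n| <= c / 6.
  have le6 : \forall n \near \oo, `|l - series e n| <= c / 6.
    by move/cvgrPdist_le : el; exact.
  exact: filterI (dle _ c3) le6.
(* The recursion unrolled from [N]: each factor [1 - g] is at most [expR (- g)], the terms [g * d]
   enter as convex combinations with [c / 3], and the errors [e] add up. *)
have sle k : s (N + k)%N <= expR (- (series g (N + k)%N - series g N)) * s N +
    c / 3 + (series e (N + k)%N - series e N).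
  elim: k => [|k ih].
    by rewrite addn0 !subrr oppr0 expR0 mul1r addr0; lra.
  rewrite addnS !seriesSr; apply: le_trans (sS _) _.
  have /andP[g0 g1] := g01 (N + k)%N; have [dk _] := NP _ (leq_addr k N).
  have en : 0 <= series e (N + k)%N - series e N.
    by rewrite sub_series_geq ?leq_addr// sumr_ge0.
  have gexp : 1 - g (N + k)%N <= expR (- g (N + k)%N) by exact: expR_ge1Dx.
  have -> : - (series g (N + k)%N + g (N + k)%N - series g N) =
    - (series g (N + k)%N - series g N) + - g (N + k)%N by ring.
  rewrite expRD; move: ih; set E := expR (- (_ - _)) => ih.
  have E0 : 0 <= E * s N by rewrite mulr_ge0// expR_ge0.
  have h1 : (1 - g (N + k)%N) * s (N + k)%N <= (1 - g (N + k)%N) *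
      (E * s N + c / 3 + (series e (N + k)%N - series e N)).
    by rewrite ler_wpM2l// subr_ge0.
  have h2 : (1 - g (N + k)%N) * (E * s N) <= expR (- g (N + k)%N) * (E * s N).
    by rewrite ler_wpM2r.
  have h3 : g (N + k)%N * d (N + k)%N <= g (N + k)%N * (c / 3).
    by rewrite ler_wpM2l.
  have h4 : 0 <= g (N + k)%N * (series e (N + k)%N - series e N).
    by rewrite mulr_ge0.
  nra.
have exp0 : expR (- series g n) * (expR (series g N) * s N) @[n --> \oo] --> 0.
  rewrite -[X in _ --> X](mul0r (expR (series g N) * s N)); apply: cvgMl.
  exact: cvg_comp goo (@cvgr_expR R).
move/cvgrPdist_le : exp0 => /(_ _ c3)[M _ MP].
exists (maxn N M) => // n /=; rewrite geq_max => /andP[Nn Mn].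
rewrite sub0r normrN ger0_norm//.
have := MP _ Mn; rewrite sub0r normrN ger0_norm; last first.
  by rewrite !mulr_ge0// expR_ge0.
have [_] := NP _ Nn; have [_] := NP _ (leqnn N).
rewrite !ler_norml => /andP[? ?] /andP[? ?].
have := sle (n - N)%N; rewrite subnKC// opprB expRD; lra.
Qed.

Lemma is_cvg_series_lincomb {R : realType} (u v : nat -> R) (a b : R) :
  cvgn (series u) -> cvgn (series v) ->
  cvgn (series (fun n => a * u n + b * v n)).
Proof.
move=> cu cv.
have -> : series (fun n => a * u n + b * v n) =
    (fun n => a * series u n + b * series v n).
  by apply/funext => n; rewrite !seriesEnat/= big_split/= !mulr_sumr.
by apply: is_cvgD; apply: is_cvgMr.
Qed.

(** * Inner product identities and a Cauchy criterion *)

Section hilbert.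
Context {R : realType} {X : completeNormedModType R}.
Context (dot : {dot X for @idfun R}).
Hypothesis dot_norm : forall x : X, dot x x = `|x| ^+ 2.
Implicit Types (x y z u v p q : X) (C : set X).

Lemma dot_sym x y : dot x y = dot y x.
Proof. by have := @hermitian_subproof _ _ _ _ dot x y; rewrite expr0 mul1r. Qed.

Lemma dotDl x y z : dot (x + y) z = dot x z + dot y z.
Proof. exact: linearDl. Qed.

Lemma dotDr x y z : dot z (x + y) = dot z x + dot z y.
Proof. exact: linearDr. Qed.

Lemma dotNl x z : dot (- x) z = - dot x z.
Proof. exact: linearNl. Qed.

Lemma dotNr x z : dot z (- x) = - dot z x.
Proof. exact: linearNr. Qed.

Lemma dotZl k x z : dot (k *: x) z = k * dot x z.
Proof. by rewrite linearZl_LR. Qed.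

Lemma dotZr k x z : dot z (k *: x) = k * dot z x.
Proof. by rewrite linearZr_LR. Qed.

Definition dotE := (dotDl, dotDr, dotNl, dotNr, dotZl, dotZr).

Lemma dot_ge0 x : 0 <= dot x x.
Proof. by rewrite dot_norm sqr_ge0. Qed.

Lemma norm_le_dot x y : (`|x| <= `|y|) = (dot x x <= dot y y).
Proof. by rewrite !dot_norm ler_sqr ?nnegrE. Qed.

Lemma dist_triangle x y z : `|x - z| <= `|x - y| + `|y - z|.
Proof. exact: ler_distD. Qed.

Lemma cauchy_schwarz x y : dot x y <= `|x| * `|y|.
Proof.
have [->|x0] := eqVneq x 0; first by rewrite linear0l normr0 mul0r.
have [->|y0] := eqVneq y 0; first by rewrite linear0r normr0 mulr0.
have xy0 : 0 < `|x| * `|y| by rewrite mulr_gt0 ?normr_gt0.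
have := dot_ge0 (`|y| *: x - `|x| *: y).
rewrite !dotE !dot_norm (dot_sym y x) => h.
rewrite -(ler_pM2l xy0); nra.
Qed.

(** The filter is arbitrary so that the criterion covers both minimizing sequences, as n tends to
    infinity, and the approximants z_t, as t tends to 0 from the right. *)
Lemma cvg_dist_sqr {T : Type} (F : set_system T) {FF : ProperFilter F}
    (z : T -> X) (g : T -> R) (P : set T) : F P -> g @ F --> (0 : R) ->
  (forall s t, P s -> P t -> `|z s - z t| ^+ 2 <= g s + g t) ->
  cvg (z @ F).
Proof.
move=> FP g0 zg; apply/cauchy_cvgP/cauchy_exP => e e0.
have Fg : \forall t \near F, g t < e ^+ 2 / 2.
  have e2 : 0 < e ^+ 2 / 2 by rewrite divr_gt0// exprn_gt0.
  by move/cvgrPdist_lt : g0 => /(_ _ e2); apply: filterS => t;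
    rewrite sub0r normrN; exact/le_lt_trans/ler_norm.
have [s [Ps gs]] := filter_ex (filterI FP Fg).
exists (z s); apply: filterS (filterI FP Fg) => t [Pt gt].
rewrite -ball_normE/= -ltr_sqr ?nnegrE ?(ltW e0)//.
by rewrite (le_lt_trans (zg s t Ps Pt))//; lra.
Qed.

Lemma cvg_dist_sqrl {T : Type} (F : set_system T) {FF : Filter F}
    (z : T -> X) v q : z @ F --> q ->
  `|v - z t| ^+ 2 @[t --> F] --> `|v - q| ^+ 2.
Proof.
move=> zq; have h : `|v - z t| @[t --> F] --> `|v - q|.
  by apply: cvg_norm; apply: cvgB => //; exact: cvg_cst.
by rewrite expr2; under eq_fun do rewrite expr2; exact: cvgM.
Qed.

(** Turns a vector identity into an identity in [R], where [ring] applies; most vector rewritings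
    below go through it. *)
Lemma dot_inj u v : (forall w, dot u w = dot v w) -> u = v.
Proof.
move=> uv; apply/eqP; rewrite -subr_eq0 -normr_eq0 -sqrf_eq0 -dot_norm.
by rewrite dotDl dotNl uv subrr.
Qed.

(** * Convex sets and the metric projection *)

Lemma convex_comb C x y (t : R) : convex_set C -> C x -> C y ->
  0 <= t <= 1 -> C (t *: x + (1 - t) *: y).
Proof.
move=> Cc Cx Cy /andP[t0 t1].
have := @Cc x y (Itv01 t0 t1); rewrite !inE => /(_ Cx Cy).
by [].
Qed.

Lemma nearest_points_obtuse C x p y : convex_set C ->
  nearest_points C x p -> C y -> dot (x - p) (y - p) <= 0.
Proof.
move=> Cc [Cp px] Cy; rewrite leNgt; apply/negP => h.
have d0 := dot_ge0 (y - p).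
(* moving a small distance from [p] towards [y] would get closer to [x] *)
pose D := dot (x - p) (y - p); pose E := dot (y - p) (y - p).
(* This [t] lies in (0, 1] and satisfies [t * E <= D], whereas minimality of [p] forces
   [2 * D <= t * E]. *)
pose t := D / (D + E + 1).
have DE : 0 < D + E + 1 by rewrite /D /E; lra.
have tD : t * (D + E + 1) = D by rewrite /t divfK// gt_eqF.
have t0 : 0 < t by rewrite divr_gt0.
have t1 : t <= 1 by rewrite ler_pdivrMr// mul1r /E; lra.
have := px _ (convex_comb Cc Cy Cp (introT andP (conj (ltW t0) t1))).
have -> : x - (t *: y + (1 - t) *: p) = (x - p) - t *: (y - p).
  by apply: dot_inj => w; rewrite !dotE; ring.
move: tD h d0; rewrite norm_le_dot /D /E.
move: (x - p) (y - p) => d e tD h d0; rewrite !dotE (dot_sym e d) => hh.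
have : 2 * dot d e <= t * dot e e by rewrite -(ler_pM2l t0); lra.
have : t * dot e e <= dot d e by nra.
lra.
Qed.

(** Adding the two inequalities gives |p - q|^2 <= <u - v, p - q>, and Cauchy-Schwarz concludes.
    This one estimate gives nonexpansiveness of projections and, for [u = v], their uniqueness. *)
Lemma obtuse_dist u v p q : dot (u - p) (q - p) <= 0 ->
  dot (v - q) (p - q) <= 0 -> `|p - q| <= `|u - v|.
Proof.
move=> up vq; have := cauchy_schwarz (u - v) (p - q).
have : dot (p - q) (p - q) <= dot (u - v) (p - q).
  by move: up vq; rewrite !dotE; lra.
rewrite dot_norm; have := normr_ge0 (p - q); have := normr_ge0 (u - v).
by nra.
Qed.

Lemma obtuse_unique u p q : dot (u - p) (q - p) <= 0 ->
  dot (u - q) (p - q) <= 0 -> p = q.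
Proof.
move=> up uq; have := obtuse_dist up uq.
by rewrite subrr normr0 normr_le0 subr_eq0 => /eqP.
Qed.

Lemma obtuse_nearest C x p : C p -> (forall y, C y -> dot (x - p) (y - p) <= 0) ->
  nearest_points C x p.
Proof.
move=> Cp px; split=> // y /px h.
rewrite norm_le_dot.
have := dot_ge0 (y - p).
by move: h; rewrite !dotE; have := dot_sym x y; have := dot_sym x p;
  have := dot_sym y p; lra.
Qed.

(** A minimizing sequence is Cauchy by the parallelogram identity, since the midpoint of two of its
    terms stays in [C] and so is no closer to [x] than the infimum. *)
Lemma nearest_points_nonempty C x : closed C -> convex_set C -> C !=set0 ->
  nearest_points C x !=set0.
Proof.
move=> Cl Cc [c0 Cc0].
pose S := [set `|x - y| ^+ 2 | y in C].
have lS : has_inf S.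
  split; first by exists (`|x - c0| ^+ 2); exists c0.
  by exists 0 => _ [y _ <-]; exact: sqr_ge0.
have inf_le y : C y -> inf S <= `|x - y| ^+ 2.
  by move=> Cy; apply: ge_inf; [exact: lS.2|exists y].
have ex n : exists y, C y /\ `|x - y| ^+ 2 < inf S + n.+1%:R^-1.
  have [|_ [y Cy <-] yn] := inf_adherent _ lS (eps := n.+1%:R^-1).
    by rewrite invr_gt0.
  by exists y.
have [y yP] := choice ex.
have sq_le n m : `|y n - y m| ^+ 2 <= 2 * n.+1%:R^-1 + 2 * m.+1%:R^-1.
  have half01 : 0 <= (2^-1 : R) <= 1 by lra.
  have := inf_le _ (convex_comb Cc (yP n).1 (yP m).1 half01).
  move: (yP n).2 (yP m).2; rewrite -!dot_norm !dotE => hn hm h.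
  move: (dot_sym x (y n)) (dot_sym x (y m)) (dot_sym (y m) (y n)) => e1 e2 e3.
  move: (n.+1%:R^-1) (m.+1%:R^-1) hn hm h e1 e2 e3 => i j; lra.
have g0 : (fun n => 2 * n.+1%:R^-1) @ \oo --> (0 : R).
  by rewrite -[X in _ --> X](mulr0 2); apply: cvgMr; exact: cvg_harmonic.
have /cvg_ex[p yp] : cvgn y.
  by apply: (cvg_dist_sqr filterT g0) => n m _ _; exact: sq_le.
have Cp : C p by apply: (closed_cvg _ Cl _ _ yp); apply: nearW => n; exact: (yP n).1.
exists p; split=> // z Cz; rewrite -ler_sqr ?nnegrE//.
apply: le_trans (inf_le _ Cz).
have xyp : `|x - y n| ^+ 2 @[n --> \oo] --> `|x - p| ^+ 2.
  exact: cvg_dist_sqrl.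
have infn : inf S + n.+1%:R^-1 @[n --> \oo] --> inf S.
  rewrite -[X in _ --> X]addr0; apply: cvgD; first exact: cvg_cst.
  exact: cvg_harmonic.
apply: ler_cvg_to xyp infn _; apply: nearW => n; exact/ltW/(yP n).2.
Qed.

Lemma metric_projP C x : closed C -> convex_set C -> C !=set0 ->
  C (metric_proj C x) /\
  forall y, C y -> dot (x - metric_proj C x) (y - metric_proj C x) <= 0.
Proof.
move=> Cl Cc C0; have np : nearest_points C x (metric_proj C x).
  by rewrite /metric_proj; apply: getPex; exact: nearest_points_nonempty.
by split=> [|y]; [exact: np.1|exact: nearest_points_obtuse].
Qed.

Lemma metric_proj_eq C x p : convex_set C -> C p ->
  (forall y, C y -> dot (x - p) (y - p) <= 0) -> metric_proj C x = p.
Proof.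
move=> Cc Cp px; apply: get_subset1; first exact: obtuse_nearest.
move=> q r xq xr; apply: (@obtuse_unique x).
- exact: nearest_points_obtuse xr.1.
- exact: nearest_points_obtuse xq.1.
Qed.

(** * Nonexpansive maps and their approximants z_t *)

Lemma nonexpansiveP C (T : {fun C >-> C}) x y : nonexpansive T -> C x -> C y ->
  `|T x - T y| <= `|x - y|.
Proof. by move=> nT Cx Cy; rewrite -[leRHS]mul1r; exact: (nT (x, y)). Qed.

Lemma nonexpansive_monotone C (T : {fun C >-> C}) x y : nonexpansive T ->
  C x -> C y -> 0 <= dot (x - y) ((x - T x) - (y - T y)).
Proof.
move=> nT Cx Cy; have := nonexpansiveP nT Cx Cy; rewrite norm_le_dot => h.
have := cauchy_schwarz (x - y) (T x - T y); have := nonexpansiveP nT Cx Cy.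
have := dot_norm (x - y); have := normr_ge0 (x - y).
have -> : (x - T x) - (y - T y) = (x - y) - (T x - T y).
  by apply: dot_inj => w; rewrite !dotE; ring.
by rewrite dotDr dotNr; nra.
Qed.

Section approximants.
Context (C : set X) (T : {fun C >-> C}) (u : X).
Hypotheses (Ccl : closed C) (Cc : convex_set C) (nT : nonexpansive T) (Cu : C u).

Lemma approx_fixP (t : R) : 0 < t < 1 ->
  C (approx_fix C T u t) /\
  t *: u + (1 - t) *: T (approx_fix C T u t) = approx_fix C T u t.
Proof.
move=> /andP[t0 t1]; have t01 : 0 <= t <= 1 by rewrite !ltW.
pose g x := t *: u + (1 - t) *: T x.
have gC : {homo g : x / C x >-> C x}.
  by move=> x Cx; apply: convex_comb => //; exact: funS.
have t1' : 0 <= 1 - t by rewrite subr_ge0 ltW.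
have ctr : is_contraction (mkfun_fun gC).
  exists (NngNum t1'); split=> /=; first by rewrite gtrBl.
  move=> [x y] /= [Cx Cy]; rewrite /mkfun /g.
  have -> : t *: u + (1 - t) *: T x - (t *: u + (1 - t) *: T y) =
      (1 - t) *: (T x - T y) by apply: dot_inj => w; rewrite !dotE; ring.
  by rewrite normrZ ger0_norm// ler_wpM2l// nonexpansiveP.
have [|z Cz zE] := banach_fixed_point ctr Ccl; first by exists u.
suff : [set z | C z /\ t *: u + (1 - t) *: T z = z] (approx_fix C T u t) by [].
by apply: getPex; exists z; split=> //; rewrite [RHS]zE.
Qed.

Lemma approx_fix_residual (t : R) : 0 < t < 1 ->
  (1 - t) *: (approx_fix C T u t - T (approx_fix C T u t)) =
  t *: (u - approx_fix C T u t).
Proof.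
move=> /approx_fixP[_]; set z := approx_fix C T u t => zE.
have -> : (1 - t) *: (z - T z) = z - t *: z - (z - t *: u).
  by rewrite -{5}zE; apply: dot_inj => w; rewrite !dotE; ring.
by apply: dot_inj => w; rewrite !dotE; ring.
Qed.

(** Monotonicity of I - T between z_t and [p], whose residual vanishes; the residual of z_t is a
    positive multiple of u - z_t. *)
Lemma approx_fix_obtuse (t : R) p : 0 < t < 1 -> Fix C T p ->
  dot (u - approx_fix C T u t) (p - approx_fix C T u t) <= 0.
Proof.
move=> t01 [Cp Tp]; have [Cz _] := approx_fixP t01.
have := nonexpansive_monotone nT Cz Cp; rewrite Tp subrr subr0.
have := approx_fix_residual t01; move: t01 => /andP[t0 t1].
set z := approx_fix C T u t => zE h.
have : 0 <= dot (z - p) (t *: (u - z)).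
  by rewrite -zE dotZr mulr_ge0// subr_ge0 ltW.
rewrite dotZr pmulr_rge0// -oppr_le0 -dotNl opprB.
by rewrite dot_sym.
Qed.

Lemma approx_fix_dist (t : R) p : 0 < t < 1 -> Fix C T p ->
  `|u - approx_fix C T u t| <= `|u - p|.
Proof.
move=> t01 Fp; have := approx_fix_obtuse t01 Fp; rewrite norm_le_dot.
set z := approx_fix C T u t.
have := dot_ge0 (p - z); rewrite !dotE.
have := dot_sym u z; have := dot_sym u p; have := dot_sym p z; lra.
Qed.

(* [approx_fix] is the resolvent of the monotone map [I - T], with parameter
   [(1 - t) / t]. *)
Lemma approx_fix_dist_sqr (s t : R) : 0 < s -> s <= t -> t < 1 ->
  `|approx_fix C T u s - approx_fix C T u t| ^+ 2 <=
  `|u - approx_fix C T u s| ^+ 2 - `|u - approx_fix C T u t| ^+ 2.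
Proof.
move=> s0; rewrite le_eqVlt => /predU1P[->|st] t1.
  by rewrite !subrr normr0 expr0n.
have t0 := lt_trans s0 st; have s1 := lt_trans st t1.
have s01 : 0 < s < 1 by rewrite s0. have t01 : 0 < t < 1 by rewrite t0.
have [Cs _] := approx_fixP s01; have [Ct _] := approx_fixP t01.
have := approx_fix_residual s01; have := approx_fix_residual t01.
set x := approx_fix C T u s in Cs *; set y := approx_fix C T u t in Ct *.
move=> yE xE.
have xE' : x - T x = (s / (1 - s)) *: (u - x).
  rewrite mulrC -scalerA -xE scalerA mulVf ?scale1r// subr_eq0 gt_eqF//.
have yE' : y - T y = (t / (1 - t)) *: (u - y).
  rewrite mulrC -scalerA -yE scalerA mulVf ?scale1r// subr_eq0 gt_eqF//.
have := nonexpansive_monotone nT Cs Ct; rewrite {}xE' {}yE'.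
set a := s / (1 - s); set b := t / (1 - t).
have a0 : 0 < a by rewrite divr_gt0// subr_gt0.
have ab : 0 < b - a.
  rewrite subr_gt0 ltr_pdivrMr ?subr_gt0// mulrAC ltr_pdivlMr ?subr_gt0//.
  by nra.
move=> h.
(* Since a(u - x) - b(u - y) = (b - a)(y - u) - a(x - y), monotonicity bounds (b - a)<x - y, y - u>
   below by a|x - y|^2. *)
have h2 : 0 <= dot (x - y) (y - u).
  rewrite -(pmulr_rge0 _ ab); have := mulr_ge0 (ltW a0) (dot_ge0 (x - y)).
  by move: h; rewrite !dotE; lra.
move: h2; rewrite -!dot_norm !dotE.
have := dot_sym x y; have := dot_sym u x; have := dot_sym u y; lra.
Qed.

Lemma approx_fix_cvg : Fix C T !=set0 -> exists q,
  [/\ approx_fix C T u t @[t --> 0^'+] --> q, Fix C T q &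
      forall p, Fix C T p -> dot (u - q) (p - q) <= 0].
Proof.
move=> [p0 Fp0]; pose z := approx_fix C T u; pose D t := `|u - z t| ^+ 2.
have [l Dl] : exists l : R, D t @[t --> 0^'+] --> l.
  eexists; apply: (@nonincreasing_at_right_cvgr _ D 0 (BLeft 1)).
  - by rewrite bnd_simp.
  - move=> s t; rewrite !in_itv/= => /andP[s0 _] /andP[_ t1] st.
    by rewrite -subr_ge0; apply: le_trans (approx_fix_dist_sqr s0 st t1);
      rewrite sqr_ge0.
  - exists (`|u - p0| ^+ 2) => y [t]; rewrite /= in_itv/= => t01 <-.
    by rewrite /D ler_sqr ?nnegrE//; exact: approx_fix_dist.
have near01 : \forall t \near (0 : R)^'+, 0 < t < 1.
  near=> t; apply/andP; split; near: t; first exact: nbhs_right_gt.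
  exact: nbhs_right_lt.
have lD : `|l - D t| @[t --> 0^'+] --> (0 : R).
  rewrite -[X in _ --> X](@normr0 _ R) -[in X in _ --> X](subrr l).
  by apply: cvg_norm; apply: cvgB => //; exact: cvg_cst.
have /cvg_ex[q zq] : cvg (z t @[t --> 0^'+]).
  apply: (cvg_dist_sqr near01 lD) => s t.
  wlog st : s t / s <= t.
    move=> W; have [|/ltW ts] := leP s t; first exact: W.
    by move=> ? ?; rewrite distrC [leRHS]addrC; exact: W.
  move=> /andP[s0 _] /andP[_ t1].
  apply: le_trans (approx_fix_dist_sqr s0 st t1) _.
  rewrite -/(z s) -/(z t) -/(D s) -/(D t).
  have -> : D s - D t = (l - D t) - (l - D s) by ring.
  by rewrite [leRHS]addrC; apply: (le_trans (ler_norm _)); exact: ler_normB.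
have Cq : C q.
  by apply: (closed_cvg _ Ccl _ _ zq); apply: filterS near01 => t /approx_fixP[].
have Tq : T q = q.
  apply/eqP; rewrite -subr_eq0 -normr_le0.
  (* This expression bounds |T q - q|: going through T z_t and z_t costs 2|q - z_t| plus the
     residual t|u - T z_t|, and |u - T z_t| <= 3|u - p0|. *)
  have hlim : 2 * `|q - z t| + t * (3 * `|u - p0|) @[t --> 0^'+] --> (0 : R).
    rewrite -[X in _ --> X](addr0 (0 : R)); apply: cvgD.
      rewrite -[X in _ --> X](mulr0 2); apply: cvgMr.
      rewrite -[X in _ --> X](@normr0 _ X) -[in X in _ --> X](subrr q).
      by apply: cvg_norm; apply: cvgB => //; exact: cvg_cst.
    rewrite -[X in _ --> X](mul0r (3 * `|u - p0|)); apply: cvgMl.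
    by apply: cvg_at_right_filter; exact: cvg_id.
  apply: cvgr_to_ge hlim _; apply: filterS near01 => t t01.
  have [Cz _] := approx_fixP t01; have [Cp0 Tp0] := Fp0.
  have [t0 t1] := andP t01; have := approx_fix_dist t01 Fp0; rewrite -/(z t).
  have hz : `|z t - T (z t)| <= t * (3 * `|u - p0|).
    have -> : z t - T (z t) = t *: (u - T (z t)).
      have [_] := approx_fixP t01; rewrite -/(z t) => {1}<-.
      by apply: dot_inj => w; rewrite !dotE; ring.
    rewrite normrZ gtr0_norm// ler_wpM2l ?(ltW t0)//.
    have := approx_fix_dist t01 Fp0; rewrite -/(z t).
    have := nonexpansiveP nT Cp0 Cz; rewrite Tp0 -/(z t).
    have := dist_triangle u p0 (T (z t)); have := dist_triangle p0 u (z t).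
    by rewrite (distrC p0 u); lra.
  have := nonexpansiveP nT Cq Cz; rewrite -/(z t).
  have := dist_triangle (T q) (T (z t)) q; have := dist_triangle (T (z t)) (z t) q.
  by rewrite (distrC (z t) q) (distrC (T (z t)) (z t)); lra.
exists q; split=> // p Fp.
(* The obtuse-angle inequality in Pythagorean form: it involves only squared distances, so it passes
   to the limit by continuity of the norm. *)
have : `|u - q| ^+ 2 + `|p - q| ^+ 2 <= `|u - p| ^+ 2.
  have hlim : `|u - z t| ^+ 2 + `|p - z t| ^+ 2 @[t --> 0^'+] -->
      `|u - q| ^+ 2 + `|p - q| ^+ 2.
    exact: cvgD (@cvg_dist_sqrl _ _ _ z u q zq)
      (@cvg_dist_sqrl _ _ _ z p q zq).
  apply: cvgr_to_le hlim _; apply: filterS near01 => t t01.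
  have := approx_fix_obtuse t01 Fp.
  rewrite -/(z t) -!dot_norm !dotE.
  have := dot_sym u p; have := dot_sym (z t) p; have := dot_sym (z t) u; lra.
rewrite -!dot_norm !dotE.
have := dot_sym u p; have := dot_sym q p; have := dot_sym q u; lra.
Unshelve. all: by end_near. Qed.

End approximants.

(** * The retraction R_T and the point Q_F(f) *)

Lemma retract_limP C (T : {fun C >-> C}) u : closed C -> convex_set C ->
  nonexpansive T -> Fix C T !=set0 -> C u ->
  [/\ approx_fix C T u t @[t --> 0^'+] --> retract_lim C T u,
      Fix C T (retract_lim C T u) &
      forall p, Fix C T p ->
        dot (u - retract_lim C T u) (p - retract_lim C T u) <= 0].
Proof.
move=> Ccl Cc nT FT Cu; have [q [zq Fq qP]] := approx_fix_cvg Ccl Cc nT Cu FT.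
suff -> : retract_lim C T u = q by split.
exact: cvg_lim zq.
Qed.

Lemma contractionP C (f : {fun C >-> C}) (alpha : {nonneg R}) x y :
  contraction alpha f -> C x -> C y -> `|f x - f y| <= alpha%:num * `|x - y|.
Proof. by move=> [_ fl] Cx Cy; exact: (fl (x, y)). Qed.

(** R_T is nonexpansive by [obtuse_dist], so its composition with [f] is a contraction. The
    inequality characterizing R_T mentions only the fixed point set, so the same [q] serves every
    [S] with that set. *)
Lemma is_QP C (T : {fun C >-> C}) (f : {fun C >-> C}) (alpha : {nonneg R}) :
  closed C -> convex_set C -> contraction alpha f ->
  nonexpansive T -> Fix C T !=set0 ->
  exists q, [/\ is_Q C (Fix C T) f q, Fix C T q &
    forall p, Fix C T p -> dot (f q - q) (p - q) <= 0].
Proof.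
move=> Ccl Cc fa nT FT; have [p0 [Cp0 _]] := FT.
have Cf x : C x -> C (f x) by exact: funS.
pose g := retract_lim C T \o f.
have gP x (Cx : C x) := retract_limP Ccl Cc nT FT (Cf _ Cx).
have gC : {homo g : x / C x >-> C x} by move=> x /gP[_ []].
have ctr : is_contraction (mkfun_fun gC).
  exists alpha; split; first exact: fa.1.
  move=> [x y] /= [Cx Cy]; apply: le_trans (contractionP fa Cx Cy).
  have [_ Fx xP] := gP _ Cx; have [_ Fy yP] := gP _ Cy.
  by apply: obtuse_dist; [exact: xP|exact: yP].
have [|q Cq qE] := banach_fixed_point ctr Ccl; first by exists p0.
have {}qE : retract_lim C T (f q) = q by rewrite [RHS]qE.
have := gP _ Cq; rewrite qE => -[_ Fq qP].
exists q; split=> //; split; first by exists T.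
move=> S nS FS; have S0 : Fix C S !=set0 by rewrite FS.
have SP u := retract_limP Ccl Cc nS S0 (u := u).
split=> //.
- by move=> u /SP[zu _ _]; apply/cvg_ex; exists (retract_lim C S u).
- have [_ Fs sP] := SP _ (Cf _ Cq).
  by apply: (@obtuse_unique (f q)); [apply: sP; rewrite FS|apply: qP; rewrite -FS].
- move=> p Cp pE; have := SP _ (Cf _ Cp); rewrite pE FS => -[_ Fp pP].
  apply/eqP; rewrite -subr_eq0 -normr_le0 leNgt; apply/negP => pq.
  have := obtuse_dist (pP _ Fq) (qP _ Fp).
  have := contractionP fa Cp Cq; have := fa.1; nra.
Qed.

(** * The maps T_l = P_C(I - l A) *)

Section projection_step.
Context (C : set X) (A : X -> X) (mu : R).
Hypotheses (Ccl : closed C) (Cc : convex_set C) (C0 : C !=set0).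

Lemma proj_step_in (l : R) x : C (proj_step C A l x).
Proof. exact: (metric_projP _ Ccl Cc C0).1. Qed.

(** At a fixed point, the obtuse-angle inequality of the projection is the variational inequality
    multiplied by [- l]. *)
Lemma Fix_proj_step (l : R) : 0 < l -> Fix C (proj_step C A l) = VI dot C A.
Proof.
move=> l0; apply/seteqP; split=> x [Cx].
  move=> xE; split=> // y Cy.
  have := (metric_projP (x - l *: A x) Ccl Cc C0).2 _ Cy.
  rewrite -[metric_proj _ _]/(proj_step C A l x) xE addrAC subrr add0r.
  by rewrite dotNl dotZl oppr_le0 pmulr_rge0.
move=> xP; split=> //; apply: metric_proj_eq => // y Cy.
by rewrite addrAC subrr add0r dotNl dotZl oppr_le0 pmulr_rge0// xP.
Qed.

Lemma metric_proj_nonexpansive u v :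
  `|metric_proj C u - metric_proj C v| <= `|u - v|.
Proof.
have [Cu uP] := metric_projP u Ccl Cc C0.
have [Cv vP] := metric_projP v Ccl Cc C0.
by apply: obtuse_dist; [exact: uP|exact: vP].
Qed.

(** With d = x - y and e = A x - A y, inverse strong monotonicity gives |d - l e|^2 <= |d|^2 - l(2
    mu - l)|e|^2. *)
Lemma proj_step_nonexpansive (l : R) x y :
  inverse_strongly_monotone dot C mu A -> 0 <= l <= 2 * mu -> C x -> C y ->
  `|proj_step C A l x - proj_step C A l y| <= `|x - y|.
Proof.
move=> Aism /andP[l0 l2] Cx Cy; apply: le_trans (metric_proj_nonexpansive _ _) _.
have -> : x - l *: A x - (y - l *: A y) = (x - y) - l *: (A x - A y).
  by apply: dot_inj => w; rewrite !dotE; ring.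
have := Aism _ _ Cx Cy; rewrite norm_le_dot -dot_norm.
move: (x - y) (A x - A y) => d e h.
have := dot_ge0 e; rewrite !dotE (dot_sym e d) => e0.
have : l * (l * dot e e) <= l * (2 * mu * dot e e).
  by rewrite ler_wpM2l// ler_wpM2r.
have : l * (mu * dot e e) <= l * dot d e by rewrite ler_wpM2l.
lra.
Qed.

Lemma proj_step_distl (l m : R) x :
  `|proj_step C A l x - proj_step C A m x| <= `|l - m| * `|A x|.
Proof.
apply: le_trans (metric_proj_nonexpansive _ _) _.
have -> : x - l *: A x - (x - m *: A x) = (m - l) *: A x.
  by apply: dot_inj => w; rewrite !dotE; ring.
by rewrite normrZ distrC.
Qed.

(** Test the inequality for T_l x at T_m x with weight [m], and that for T_m x at T_l x with weight
    [l]: the terms in [A x] cancel. With r and s the residual norms for [l] and [m], Cauchy-Schwarz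
    leaves (m r - l s)(r - s) <= 0, which excludes r > s. *)
Lemma proj_step_residual_le (l m : R) x : 0 < l -> l <= m ->
  `|x - proj_step C A l x| <= `|x - proj_step C A m x|.
Proof.
move=> l0 lm; have [Cl lP] := metric_projP (x - l *: A x) Ccl Cc C0.
have [Cm mP] := metric_projP (x - m *: A x) Ccl Cc C0.
move: lP mP Cl Cm; rewrite -!/(proj_step _ _ _ _).
set p := proj_step C A l x; set q := proj_step C A m x => lP mP Cp Cq.
have := mulr_ge0_le0 (le_trans (ltW l0) lm) (lP _ Cq).
have := mulr_ge0_le0 (ltW l0) (mP _ Cp).
have -> : x - l *: A x - p = (x - p) - l *: A x by rewrite addrAC.
have -> : x - m *: A x - q = (x - q) - m *: A x by rewrite addrAC.
have -> : q - p = (x - p) - (x - q) by apply: dot_inj => w; rewrite !dotE; ring.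
have -> : p - q = (x - q) - (x - p) by apply: dot_inj => w; rewrite !dotE; ring.
have := cauchy_schwarz (x - p) (x - q).
have := normr_ge0 (x - p); have := normr_ge0 (x - q).
have := dot_norm (x - p); have := dot_norm (x - q).
move: (x - p) (x - q) => e g; rewrite !dotE (dot_sym g e).
move: (dot e e) (dot g g) (dot (A x) e) (dot (A x) g) (dot e g) `|e| `|g|.
move=> ee gg ae ag eg ne ng -> -> ng0 ne0 cs h1 h2.
rewrite leNgt; apply/negP => gte.
have h : m * ne ^+ 2 + l * ng ^+ 2 <= (m + l) * (ne * ng) by nra.
have : (m * ne - l * ng) * (ne - ng) <= 0 by lra.
rewrite pmulr_lle0 ?subr_gt0//; nra.
Qed.

End projection_step.

(** * The limsup estimate through the approximants *)

Lemma limsup_dot_le0 C (T : {fun C >-> C}) u q (x : nat -> X) (B : R) :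
  closed C -> convex_set C -> nonexpansive T -> C u -> Fix C T q ->
  (forall p, Fix C T p -> dot (u - q) (p - q) <= 0) ->
  (forall n, C (x n)) -> (forall n, `|x n - q| <= B) ->
  `|x n - T (x n)| @[n --> \oo] --> (0 : R) ->
  forall c, 0 < c -> \forall n \near \oo, dot (u - q) (x n - q) <= c.
Proof.
move=> Ccl Cc nT Cu Fq qP Cx xB xT c c0.
have [|q' [zq' Fq' q'P]] := approx_fix_cvg Ccl Cc nT Cu; first by exists q.
have zq : approx_fix C T u t @[t --> 0^'+] --> q.
  by rewrite -(obtuse_unique (q'P _ Fq) (qP _ Fq')).
have B0 : 0 <= B := le_trans (normr_ge0 _) (xB 0%N).
pose K := `|u - q| + B + 1.
have K0 : 0 < K by rewrite ltr_wpDl// addr_ge0.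
(* [t] is fixed before [n]: first z_t is brought close to [q], then the residual of x_n is made
   small relative to [t]. [K] bounds the total factor of |q - z_t| in the last two terms of
   [split_dot]. *)
have [t [t01 zt]] : exists t, 0 < t < 1 /\
    `|q - approx_fix C T u t| <= c / 2 / K.
  apply: (@filter_ex _ ((0 : R)^'+)); near=> t; split.
    apply/andP; split; near: t; first exact: nbhs_right_gt.
    exact: nbhs_right_lt.
  near: t; move/cvgrPdist_le : zq; apply.
  by rewrite !divr_gt0.
set z := approx_fix C T u t in zt.
have [t0 _] := andP t01; have [Cz _] := approx_fixP Ccl Cc nT Cu t01.
have zres := approx_fix_residual Ccl Cc nT Cu t01; rewrite -/z in Cz zres.
have uz : `|u - z| <= `|u - q| by exact: approx_fix_dist Fq.
pose L := B + `|q - z| + 1.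
have L0 : 0 < L by rewrite ltr_wpDl// addr_ge0.
have : \forall n \near \oo, `|x n - T (x n)| <= t * (c / 2) / L.
  have e0 : 0 < t * (c / 2) / L by rewrite divr_gt0// mulr_gt0// divr_gt0.
  move/cvgrPdist_le : xT => /(_ _ e0); apply: filterS => n.
  by rewrite sub0r normrN normr_id.
apply: filterS => n xn.
have split_dot : dot (u - q) (x n - q) =
    dot (u - z) (x n - z) + dot (u - z) (z - q) + dot (z - q) (x n - q).
  by rewrite !dotE; ring.
have xz : `|x n - z| <= L.
  have := dist_triangle (x n) q z; have := xB n; rewrite /L; lra.
(* By monotonicity of I - T, the residual of [z], a multiple of [u - z], may be replaced by that of
   [x n]. *)
have first_term : dot (u - z) (x n - z) <= c / 2.
  rewrite -(ler_pM2l t0).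
  have -> : t * dot (u - z) (x n - z) = (1 - t) * dot (z - T z) (x n - z).
    by rewrite -!dotZl zres.
  have := nonexpansive_monotone nT (Cx n) Cz.
  have -> : dot (x n - z) (x n - T (x n) - (z - T z)) =
      dot (x n - T (x n)) (x n - z) - dot (z - T z) (x n - z).
    by rewrite dotDr dotNr dot_sym [in X in _ - X]dot_sym.
  have := cauchy_schwarz (x n - T (x n)) (x n - z).
  have : `|x n - T (x n)| * `|x n - z| <= t * (c / 2) / L * L by rewrite ler_pM.
  rewrite divfK ?gt_eqF//.
  have := mulr_ge0 (normr_ge0 (x n - T (x n))) (normr_ge0 (x n - z)).
  by case/andP: t01; nra.
have zqK : `|q - z| * K <= c / 2 by rewrite -ler_pdivlMr.
have := cauchy_schwarz (u - z) (z - q); have := cauchy_schwarz (z - q) (x n - q).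
rewrite (distrC z q) split_dot; have := xB n.
have := normr_ge0 (q - z); move: zqK; rewrite /K; nra.
Unshelve. all: by end_near. Qed.

(** * The viscosity iteration: boundedness, vanishing increments and convergence *)

Section iteration.
Context (C : set X) (f : {fun C >-> C}) (alpha : {nonneg R}) (A : X -> X).
Context (mu a b : R) (alpha_ lambda_ : nat -> R) (x : nat -> X).
Hypotheses (Ccl : closed C) (Cc : convex_set C) (C0 : C !=set0).
Hypotheses (fa : contraction alpha f) (mu0 : 0 < mu).
Hypothesis Aism : inverse_strongly_monotone dot C mu A.
Hypothesis alpha_01 : forall n, 0 < alpha_ n < 1.
Hypotheses (a0 : 0 < a) (b2mu : b < 2 * mu).
Hypothesis lambda_ab : forall n, a <= lambda_ n <= b.
Hypothesis Cx0 : C (x 0%N).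
Hypothesis x_rec : forall n, x n.+1 =
  alpha_ n *: f (x n) + (1 - alpha_ n) *: proj_step C A (lambda_ n) (x n).

Local Notation T n := (proj_step C A (lambda_ n)).

Let al1 : alpha%:num < 1. Proof. exact: fa.1. Qed.

Let Cf y : C y -> C (f y). Proof. by move=> Cy; exact: funS. Qed.

Let CT n y : C (T n y). Proof. exact: proj_step_in. Qed.

Lemma iterate_in n : C (x n).
Proof.
elim: n => // n Cn; rewrite x_rec; apply: convex_comb => //; first exact: Cf.
by have /andP[/ltW -> /ltW ->] := alpha_01 n.
Qed.

Let lambda_gt0 n : 0 < lambda_ n.
Proof. by have /andP[+ _] := lambda_ab n; exact: lt_le_trans. Qed.

Let lambda_le n : lambda_ n <= 2 * mu.
Proof. by have /andP[_ /le_trans ->] := lambda_ab n; rewrite ?ltW. Qed.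

Let lT n y z : C y -> C z -> `|T n y - T n z| <= `|y - z|.
Proof.
move=> Cy Cz; apply: proj_step_nonexpansive => //; first exact: Aism.
by rewrite ltW/=.
Qed.

Let T_VI n p : VI dot C A p -> T n p = p.
Proof.
by rewrite -(Fix_proj_step A Ccl Cc C0 (lambda_gt0 n)) => -[].
Qed.

(** The part of [C] within [K] of [p] is invariant: [f] maps it within alpha K + (1 - alpha) K of
    [p], each T_n fixes [p] and is nonexpansive, and the update is a convex combination. *)
Lemma iterate_dist_le p K : VI dot C A p -> `|x 0%N - p| <= K ->
  `|f p - p| <= (1 - alpha%:num) * K -> forall n, `|x n - p| <= K.
Proof.
move=> Vp x0K fK; elim=> // n ih; have Cp : C p := Vp.1.
rewrite x_rec; have /andP[an0 an1] := alpha_01 n.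
have -> : alpha_ n *: f (x n) + (1 - alpha_ n) *: T n (x n) - p =
    alpha_ n *: (f (x n) - p) + (1 - alpha_ n) *: (T n (x n) - p).
  by apply: dot_inj => w; rewrite !dotE; ring.
apply: le_trans (ler_normD _ _) _.
rewrite !normrZ (gtr0_norm an0) gtr0_norm ?subr_gt0//.
have h1 : `|f (x n) - p| <= K.
  have := contractionP fa (iterate_in n) Cp.
  have : alpha%:num * `|x n - p| <= alpha%:num * K by rewrite ler_wpM2l.
  have := dist_triangle (f (x n)) (f p) p; lra.
have h2 : `|T n (x n) - p| <= K.
  have := lT n (iterate_in n) Cp; rewrite (T_VI n Vp); lra.
have : alpha_ n * `|f (x n) - p| <= alpha_ n * K by rewrite ler_wpM2l ?(ltW an0).
have : (1 - alpha_ n) * `|T n (x n) - p| <= (1 - alpha_ n) * K.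
  by rewrite ler_wpM2l// subr_ge0 ltW.
lra.
Qed.

Lemma iterate_bounded p : VI dot C A p -> exists B, 0 <= B /\
  forall n, [/\ `|x n - p| <= B, `|f (x n) - T n (x n)| <= B & `|A (x n)| <= B].
Proof.
move=> Vp; have Cp : C p := Vp.1.
pose K := `|x 0%N - p| + `|f p - p| / (1 - alpha%:num).
have K1 : 0 <= `|f p - p| / (1 - alpha%:num) by rewrite divr_ge0// subr_ge0 ltW.
have x0K : `|x 0%N - p| <= K by rewrite lerDl.
have fK : `|f p - p| <= (1 - alpha%:num) * K.
  by rewrite mulrC -ler_pdivrMr ?subr_gt0// lerDr.
have xK := iterate_dist_le Vp x0K fK.
have K0 : 0 <= K := le_trans (normr_ge0 _) x0K.
pose L := K / mu + `|A p|.
have L0 : 0 <= L by rewrite addr_ge0// divr_ge0// ltW.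
(* The distance from f(x_n) to T_n x_n is split at f(p) and [p] into three parts of size at most
   [K]; [L] bounds A(x_n) because [A] is 1/mu-Lipschitz on [C]. *)
exists (3 * K + L); split; first by lra.
move=> n; have Cn := iterate_in n; have xn := xK n; split; first by lra.
- have := contractionP fa Cn Cp.
  have := lT n Cn Cp; rewrite (T_VI n Vp).
  have : alpha%:num * `|x n - p| <= 1 * K by rewrite ler_pM// ltW.
  have := dist_triangle (f (x n)) (f p) (T n (x n)).
  have := dist_triangle (f p) p (T n (x n)); rewrite (distrC p).
  have : (1 - alpha%:num) * K <= 1 * K by rewrite ler_wpM2r// gerBl.
  lra.
- have h : `|A (x n) - A p| <= K / mu.
    rewrite ler_pdivlMr// mulrC; have := Aism Cn Cp.
    have := cauchy_schwarz (x n - p) (A (x n) - A p).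
    have := normr_ge0 (A (x n) - A p).
    rewrite le_eqVlt => /predU1P[<-|An0]; first by move=> *; rewrite mulr0.
    move=> h1 h2; have : mu * `|A (x n) - A p| * `|A (x n) - A p| <=
      `|x n - p| * `|A (x n) - A p| by lra.
    by rewrite ler_pM2r// => /le_trans; apply.
  have := dist_triangle (A (x n)) (A p) 0; rewrite !subr0 /L; lra.
Qed.

Lemma iterate_increment_le B n :
  `|f (x n) - T n (x n)| <= B -> `|A (x n)| <= B -> 0 <= B ->
  `|x n.+2 - x n.+1| <=
    (1 - (1 - alpha%:num) * alpha_ n.+1) * `|x n.+1 - x n| +
    B * `|alpha_ n.+1 - alpha_ n| + B * `|lambda_ n.+1 - lambda_ n|.
Proof.
move=> fB AB B0; have Cn := iterate_in n; have Cn1 := iterate_in n.+1.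
have /andP[an0 an1] := alpha_01 n.+1.
(* The iterate, the step size and the weight are changed one at a time; the first two terms together
   give the contraction factor. *)
have step : x n.+2 - x n.+1 = alpha_ n.+1 *: (f (x n.+1) - f (x n)) +
    (1 - alpha_ n.+1) *: (T n.+1 (x n.+1) - T n.+1 (x n)) +
    (1 - alpha_ n.+1) *: (T n.+1 (x n) - T n (x n)) +
    (alpha_ n.+1 - alpha_ n) *: (f (x n) - T n (x n)).
  by rewrite (x_rec n.+1) {3}(x_rec n); apply: dot_inj => w; rewrite !dotE; ring.
have h1 := contractionP fa Cn1 Cn; have h2 := lT n.+1 Cn1 Cn.
have h3 := proj_step_distl A Ccl Cc C0 (lambda_ n.+1) (lambda_ n) (x n).
have h4 : `|lambda_ n.+1 - lambda_ n| * `|A (x n)| <=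
    B * `|lambda_ n.+1 - lambda_ n| by rewrite mulrC ler_wpM2r.
have h5 : `|alpha_ n.+1 - alpha_ n| * `|f (x n) - T n (x n)| <=
    B * `|alpha_ n.+1 - alpha_ n| by rewrite mulrC ler_wpM2r.
have h6 : alpha_ n.+1 * `|f (x n.+1) - f (x n)| <=
    alpha_ n.+1 * (alpha%:num * `|x n.+1 - x n|) by rewrite ler_wpM2l ?(ltW an0).
have h7 : (1 - alpha_ n.+1) * `|T n.+1 (x n.+1) - T n.+1 (x n)| <=
    (1 - alpha_ n.+1) * `|x n.+1 - x n| by rewrite ler_wpM2l// subr_ge0 ltW.
have h8 : (1 - alpha_ n.+1) * `|T n.+1 (x n) - T n (x n)| <=
    1 * (B * `|lambda_ n.+1 - lambda_ n|).
  rewrite ler_pM// ?subr_ge0 ?(ltW an1)// ?(le_trans h3)//.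
  by rewrite gerBl ltW.
rewrite {}step; apply: le_trans (ler_normD _ _) _.
apply: le_trans (lerD (ler_normD _ _) (lexx _)) _.
apply: le_trans (lerD (lerD (ler_normD _ _) (lexx _)) (lexx _)) _.
rewrite !normrZ (gtr0_norm an0) (gtr0_norm (_ : 0 < 1 - alpha_ n.+1)) ?subr_gt0//.
lra.
Qed.

Hypothesis alpha_cvg0 : alpha_ n @[n --> \oo] --> (0 : R).
Hypothesis alpha_series : series alpha_ @ \oo --> +oo.
Hypothesis alpha_var :
  cvgn (series (fun n => `|alpha_ n.+1 - alpha_ n|)) \/
  alpha_ n.+1 / alpha_ n @[n --> \oo] --> (1 : R).
Hypothesis lambda_var : cvgn (series (fun n => `|lambda_ n.+1 - lambda_ n|)).

Let contr_factor n : 0 <= (1 - alpha%:num) * alpha_ n <= 1.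
Proof.
have /andP[/ltW an0 /ltW an1] := alpha_01 n.
have c0 : 0 <= 1 - alpha%:num by rewrite subr_ge0 ltW.
by rewrite mulr_ge0//= mulr_ile1// gerBl.
Qed.

(** The shift [k] is 1 for the increments, whose factor involves [alpha_ n.+1], and 0 for the
    squared distances to the limit. *)
Let contr_factor_series k :
  series (fun n => (1 - alpha%:num) * alpha_ (n + k)%N) @ \oo --> +oo.
Proof.
have c0 : 0 < 1 - alpha%:num by rewrite subr_gt0.
apply/cvgryPge => M.
move/cvgryPge : alpha_series => /(_ (M / (1 - alpha%:num) + series alpha_ k)).
move=> [N _ NP]; exists N => // n /= Nn.
have /= := NP (n + k)%N (leq_trans Nn (leq_addr _ _)).
rewrite -lerBrDr sub_series_geq ?leq_addl// ler_pdivrMr// mulrC.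
move=> /le_trans; apply; rewrite seriesEnat/= mulr_sumr -{1}(add0n k) big_addn.
by rewrite addnK.
Qed.

Lemma iterate_increment_cvg0 p : VI dot C A p ->
  `|x n.+1 - x n| @[n --> \oo] --> (0 : R).
Proof.
move=> /iterate_bounded[B [B0 BP]].
have c0 : 0 < 1 - alpha%:num by rewrite subr_gt0.
have xinc n : `|x n.+2 - x n.+1| <=
    (1 - (1 - alpha%:num) * alpha_ (n + 1)%N) * `|x n.+1 - x n| +
    B * `|alpha_ n.+1 - alpha_ n| + B * `|lambda_ n.+1 - lambda_ n|.
  by rewrite addn1; have [_ ? ?] := BP n; exact: iterate_increment_le.
case: alpha_var => [var|ratio].
  (* With summable variation, the changes of both parameters go into the error term. *)
  apply: (@recursive_inequality_cvg0 _ _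
    (fun n => (1 - alpha%:num) * alpha_ (n + 1)%N) (fun=> 0)
    (fun n => B * `|alpha_ n.+1 - alpha_ n| + B * `|lambda_ n.+1 - lambda_ n|)).
  - by [].
  - by move=> n; exact: contr_factor.
  - exact: contr_factor_series.
  - by move=> c /ltW c_ge0; exact: nearW.
  - by move=> n; rewrite addr_ge0// mulr_ge0.
  - exact: is_cvg_series_lincomb.
  - by move=> n; rewrite mulr0 addr0 addrA.
(* In the ratio case, |alpha_{n+1} - alpha_n| = alpha_{n+1} |1 - 1/rho_n| carries the factor
   alpha_{n+1}, so it goes into the [g * d] term with [d] tending to 0; only the change of lambda
   remains as error. *)
pose rho n := alpha_ n.+1 / alpha_ n.
have rho0 n : 0 < rho n.
  by have /andP[? _] := alpha_01 n.+1; have /andP[? _] := alpha_01 n;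
    rewrite divr_gt0.
apply: (@recursive_inequality_cvg0 _ _
    (fun n => (1 - alpha%:num) * alpha_ (n + 1)%N)
    (fun n => B / (1 - alpha%:num) * `|1 - (rho n)^-1|)
    (fun n => B * `|lambda_ n.+1 - lambda_ n| + 0 * `|lambda_ n.+1 - lambda_ n|)).
- by [].
- by move=> n; exact: contr_factor.
- exact: contr_factor_series.
- move=> c c_gt0.
  have d0 : B / (1 - alpha%:num) * `|1 - (rho n)^-1| @[n --> \oo] --> (0 : R).
    rewrite -[X in _ --> X](mulr0 (B / (1 - alpha%:num))); apply: cvgMr.
    rewrite -[X in _ --> X](@normr0 _ R) -[in X in _ --> X](subrr 1).
    apply: cvg_norm; apply: cvgB; first exact: cvg_cst.
    by rewrite -[X in _ --> X]invr1; apply: cvgV => //; rewrite oner_eq0.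
  move/cvgrPdist_le : d0 => /(_ _ c_gt0); apply: filterS => n.
  by rewrite sub0r normrN; exact/le_trans/ler_norm.
- by move=> n; rewrite mul0r addr0 mulr_ge0.
- exact: is_cvg_series_lincomb.
- move=> n; apply: le_trans (xinc n) _; rewrite mul0r addr0 lerD2r lerD2l.
  have /andP[an0 _] := alpha_01 n.+1; have /andP[bn0 _] := alpha_01 n.
  have -> : (rho n)^-1 = alpha_ n / alpha_ n.+1 by rewrite /rho invf_div.
  have <- : alpha_ n.+1 * `|1 - alpha_ n / alpha_ n.+1| =
      `|alpha_ n.+1 - alpha_ n|.
    rewrite -[X in X * _](gtr0_norm an0) -normrM mulrBr mulr1.
    by rewrite [_ * (_ / _)]mulrC divfK// gt_eqF.
  rewrite addn1 le_eqVlt; apply/orP; left; apply/eqP.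
  by field; rewrite gt_eqF.
Qed.

Let a_le_2mu : 0 <= a <= 2 * mu.
Proof.
by have /andP[al _] := lambda_ab 0; rewrite ltW//= (le_trans al).
Qed.

(** As a <= lambda_n, the residual for [a] is at most that for lambda_n, and x_{n+1} - T_n x_n is
    alpha_n times a bounded vector. *)
Lemma iterate_residual_cvg0 p : VI dot C A p ->
  `|x n - proj_step C A a (x n)| @[n --> \oo] --> (0 : R).
Proof.
move=> Vp; have [B [B0 BP]] := iterate_bounded Vp.
have ub : `|x n.+1 - x n| + alpha_ n * B @[n --> \oo] --> (0 : R).
  rewrite -[X in _ --> X](addr0 (0 : R)); apply: cvgD.
    exact: iterate_increment_cvg0 Vp.
  by rewrite -[X in _ --> X](mul0r B); apply: cvgMl.
apply: (squeeze_cvgr _ (cvg_cst 0) ub); apply: nearW => n; rewrite normr_ge0/=.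
have /andP[al _] := lambda_ab n; have /andP[an0 _] := alpha_01 n.
apply: le_trans (proj_step_residual_le A Ccl Cc C0 _ a0 al) _.
apply: le_trans (dist_triangle _ (x n.+1) _) _.
rewrite distrC lerD2l x_rec.
have -> : alpha_ n *: f (x n) + (1 - alpha_ n) *: T n (x n) - T n (x n) =
    alpha_ n *: (f (x n) - T n (x n)).
  by apply: dot_inj => w; rewrite !dotE; ring.
by rewrite normrZ gtr0_norm// ler_pM2l//; have [_ + _] := BP n.
Qed.

Lemma iterate_cvg q : VI dot C A q ->
  (forall p, VI dot C A p -> dot (f q - q) (p - q) <= 0) -> x @ \oo --> q.
Proof.
move=> Vq qP; have [B [B0 BP]] := iterate_bounded Vq.
have Cq : C q := Vq.1.
have c0 : 0 < 1 - alpha%:num by rewrite subr_gt0.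
(* The single map T_a, independent of [n], is the one to which the limsup estimate is applied. *)
have aC : {homo proj_step C A a : y / C y >-> C y}.
  by move=> y _; exact: proj_step_in.
have FT : Fix C (mkfun_fun aC) = VI dot C A.
  exact: (Fix_proj_step A Ccl Cc C0 a0).
have nT : nonexpansive (mkfun_fun aC).
  move=> [y z] /= [Cy Cz]; rewrite mul1r.
  exact: (proj_step_nonexpansive Ccl Cc C0 Aism a_le_2mu).
have limsup : forall c, 0 < c -> \forall n \near \oo,
    dot (f q - q) (x n - q) <= c.
  apply: (@limsup_dot_le0 _ (mkfun_fun aC) _ _ _ B) => //.
  - exact: Cf.
  - by rewrite FT.
  - by rewrite FT.
  - exact: iterate_in.
  - by move=> n; have [] := BP n.
  - exact: iterate_residual_cvg0 Vq.
have sq0 : `|x n - q| ^+ 2 @[n --> \oo] --> (0 : R).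
  apply: (@recursive_inequality_cvg0 _ _
    (fun n => (1 - alpha%:num) * alpha_ (n + 0)%N)
    (fun n => 2 / (1 - alpha%:num) * dot (f q - q) (x n.+1 - q)) (fun=> 0)).
  - by move=> n; exact: sqr_ge0.
  - by move=> n; exact: contr_factor.
  - exact: contr_factor_series.
  - move=> c c_gt0.
    have /limsup[N _ NP] : 0 < c * ((1 - alpha%:num) / 2).
      by rewrite mulr_gt0// divr_gt0.
    exists N => // n /= Nn; have /= := NP n.+1 (leqW Nn).
    by rewrite -ler_pdivrMr ?divr_gt0// invf_div mulrC.
  - by [].
  - have -> : series (fun=> 0 : R) = fun=> 0.
      by apply/funext => n; rewrite seriesEnat/= big1.
    exact: is_cvg_cst.
  move=> n; rewrite addr0 addn0.
  have /andP[an0 an1] := alpha_01 n; have Cn := iterate_in n.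
  (* [y] is the contracted part of x_{n+1} - q. The remainder v enters through |y + v|^2 <= |y|^2 +
     2<v, y + v>, which is why [d] is evaluated at [x n.+1]. *)
  pose y := alpha_ n *: (f (x n) - f q) + (1 - alpha_ n) *: (T n (x n) - q).
  have xy : x n.+1 - q = y + alpha_ n *: (f q - q).
    by rewrite x_rec; apply: dot_inj => w; rewrite !dotE; ring.
  have y_le : `|y| <= (1 - (1 - alpha%:num) * alpha_ n) * `|x n - q|.
    apply: le_trans (ler_normD _ _) _.
    rewrite !normrZ (gtr0_norm an0) gtr0_norm ?subr_gt0//.
    have h1 := contractionP fa Cn Cq.
    have h2 := lT n Cn Cq; rewrite (T_VI n Vq) in h2.
    have : alpha_ n * `|f (x n) - f q| <= alpha_ n * (alpha%:num * `|x n - q|).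
      by rewrite ler_wpM2l ?(ltW an0).
    have : (1 - alpha_ n) * `|T n (x n) - q| <= (1 - alpha_ n) * `|x n - q|.
      by rewrite ler_wpM2l// subr_ge0 ltW.
    lra.
  (* The factor lies in [0, 1], so its square is at most itself. *)
  have y2 : dot y y <= (1 - (1 - alpha%:num) * alpha_ n) * `|x n - q| ^+ 2.
    have /andP[g0 g1] := contr_factor n; rewrite dot_norm !expr2 mulrA.
    by rewrite ler_pM// (le_trans y_le)// ler_piMl// gerBl.
  have -> : (1 - alpha%:num) * alpha_ n *
      (2 / (1 - alpha%:num) * dot (f q - q) (x n.+1 - q)) =
      2 * alpha_ n * dot (f q - q) (x n.+1 - q) by field; rewrite gt_eqF.
  have := dot_ge0 (alpha_ n *: (f q - q)).
  rewrite -(dot_norm (x n.+1 - q)) xy; move: y2; clearbody y; move: (f q - q) => v.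
  by rewrite !dotE (dot_sym v y); lra.
have n0 : `|x n - q| @[n --> \oo] --> (0 : R).
  apply/cvgrPdist_lt => c c_gt0.
  have c2 : 0 < c ^+ 2 by rewrite exprn_gt0.
  move/cvgrPdist_lt : sq0 => /(_ _ c2); apply: filterS => n.
  rewrite !sub0r !normrN normr_id ger0_norm ?sqr_ge0//.
  by rewrite ltr_sqr ?nnegrE ?(ltW c_gt0).
apply/cvgrPdist_lt => c c_gt0.
move/cvgrPdist_lt : n0 => /(_ _ c_gt0); apply: filterS => n.
by rewrite sub0r normrN normr_id distrC.
Qed.

End iteration.

End hilbert.

Theorem theorem20 (R : realType) (X : completeNormedModType R)
    (dot : {dot X for @idfun R})
    (dot_norm : forall x : X, dot x x = `|x| ^+ 2)
    (C : set X) (C_neq0 : C !=set0) (C_closed : closed C)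
    (C_convex : convex_set C)
    (f : {fun C >-> C}) (alpha : {nonneg R}) (alpha_gt0 : 0 < alpha%:num)
    (f_contraction : contraction alpha f)
    (A : X -> X) (mu : R) (mu_gt0 : 0 < mu)
    (A_ism : inverse_strongly_monotone dot C mu A)
    (VI_neq0 : VI dot C A !=set0)
    (alpha_ : nat -> R)
    (alpha_01 : forall n, 0 < alpha_ n < 1)
    (alpha_cvg0 : alpha_ n @[n --> \oo] --> (0 : R))
    (alpha_sum : (\sum_(0 <= n <oo) (alpha_ n)%:E = +oo)%E)
    (alpha_var :
      (\sum_(0 <= n <oo) `|alpha_ n.+1 - alpha_ n|%:E < +oo)%E \/
      alpha_ n.+1 / alpha_ n @[n --> \oo] --> (1 : R))
    (lambda_ : nat -> R) (a b : R)
    (a_gt0 : 0 < a) (a_lt_b : a < b) (b_lt_2mu : b < 2 * mu)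
    (lambda_ab : forall n, a <= lambda_ n <= b)
    (lambda_var :
      (\sum_(1 <= n <oo) `|lambda_ n.+1 - lambda_ n|%:E < +oo)%E)
    (x : nat -> X) (x0_in_C : C (x 0%N))
    (x_rec : forall n, x n.+1 =
      alpha_ n *: f (x n) + (1 - alpha_ n) *: proj_step C A (lambda_ n) (x n)) :
  (forall lambda : R, 0 < lambda -> Fix C (proj_step C A lambda) = VI dot C A) /\
  (exists q : X, is_Q C (VI dot C A) f q /\ x n @[n --> \oo] --> q).
Proof.
have series_cvg (u : nat -> R) :
    (\sum_(0 <= n <oo) `|u n|%:E < +oo)%E -> cvgn (series (fun n => `|u n|)).
  by move=> h; exact: nnseries_is_cvg.
have alpha_series : series alpha_ @ \oo --> +oo.
  by apply: nneseries_pinfty_cvg => // n; have /andP[/ltW] := alpha_01 n.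
have alpha_var' : cvgn (series (fun n => `|alpha_ n.+1 - alpha_ n|)) \/
    alpha_ n.+1 / alpha_ n @[n --> \oo] --> (1 : R).
  by case: alpha_var => [/series_cvg|]; [left|right].
have lambda_var' : cvgn (series (fun n => `|lambda_ n.+1 - lambda_ n|)).
  (* The assumed sum starts at index 1; the term of index 0 is finite. *)
  by apply: series_cvg; rewrite nneseries_recl// lte_add_pinfty ?ltry.
have a_le_2mu : 0 <= a <= 2 * mu.
  by rewrite ltW//= ltW// (lt_trans a_lt_b).
split; first by move=> l; exact: Fix_proj_step.
(* T_a is the nonexpansive map with fixed point set VI(C, A) whose existence [is_Q] requires. *)
have aC : {homo proj_step C A a : y / C y >-> C y}.
  by move=> y _; exact: (proj_step_in dot_norm).
have FT : Fix C (mkfun_fun aC) = VI dot C A by exact: Fix_proj_step.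
have nT : nonexpansive (mkfun_fun aC).
  move=> [y z] /= [Cy Cz]; rewrite mul1r.
  exact: (proj_step_nonexpansive dot_norm C_closed C_convex C_neq0 A_ism a_le_2mu).
have FT0 : Fix C (mkfun_fun aC) !=set0 by rewrite FT.
have := is_QP dot_norm C_closed C_convex f_contraction nT FT0.
rewrite FT => -[q [Qq Vq qP]]; exists q; split=> //.
exact: (iterate_cvg dot_norm C_closed C_convex C_neq0 f_contraction mu_gt0 A_ism
  alpha_01 a_gt0 b_lt_2mu lambda_ab x0_in_C x_rec alpha_cvg0 alpha_series
  alpha_var' lambda_var' Vq qP).
Qed.
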